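(* Let $G$ be a Polish topological group. Then under every isomorphic embedding (embedding of topological groups) $\varphi\colon G\hookrightarrow\mathrm{Iso}(\mathbb U)$, the group $G$ (that is, the closed subgroup $\varphi(G)$) is the limit of a net of finite subgroups of $\mathrm{Iso}(\mathbb U)$ in the space $\mathcal L(\mathrm{Iso}(\mathbb U))$ of all closed subgroups of $\mathrm{Iso}(\mathbb U)$.
   Context: $\mathbb U$ denotes the complete separable Urysohn metric space: the unique (up to isometry) complete separable metric space such that whenever $A\subseteq\mathbb U$ is a finite metric subspace and $A'=A\cup\{a\}$ is a one-point metric space extension of $A$, the embedding $A\hookrightarrow\mathbb U$ extends to an isometric embedding $A'\hookrightarrow\mathbb U$. $\mathrm{Iso}(\mathbb U)$ is the group of all isometries of $\mathbb U$ onto itself with the topology of pointwise convergence (which equals the compact-open topology). Let $F_\infty$ be the free group of countably infinite rank. The set $\mathrm{Hom}(F_\infty,\mathrm{Iso}(\mathbb U))$ of all homomorphisms is given the topology of pointwise convergence on $F_\infty$, i.e. the topology induced from the product $\mathrm{Iso}(\mathbb U)^{F_\infty}$. The map sending $\tau\in\mathrm{Hom}(F_\infty,\mathrm{Iso}(\mathbb U))$ to the closure of $\tau(F_\infty)$ in $\mathrm{Iso}(\mathbb U)$ is a surjection onto the set $\mathcal L(\mathrm{Iso}(\mathbb U))$ of all closed subgroups of $\mathrm{Iso}(\mathbb U)$, and $\mathcal L(\mathrm{Iso}(\mathbb U))$ is equipped with the corresponding quotient topology (which is $T_0$; convergence of nets is understood in this topology). *)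

(* Defs.v *)
From HB Require Import structures.
From mathcomp Require Import all_boot all_order all_algebra.
From mathcomp Require Import all_classical all_reals all_analysis.

Set Implicit Arguments.
Unset Strict Implicit.
Unset Printing Implicit Defensive.

Import Order.TTheory GRing.Theory Num.Theory.

Local Open Scope classical_set_scope.

(* [Complete] carries a base point; the spaces considered here are nonempty. *)
#[short(type="completeMetricType")]
HB.structure Definition CompleteMetric (R : numDomainType) :=
  { M of Complete M & Metric R M }.

Definition separable_space (T : topologicalType) : Prop :=
  exists2 D : set T, countable D & dense D.

Definition homeomorphic (S T : topologicalType) : Prop :=
  exists (f : S -> T) (g : T -> S),
    [/\ cancel f g, cancel g f, continuous f & continuous g].

Definition polish (R : realType) (T : topologicalType) : Prop :=
  exists2 M : completeMetricType R, separable_space M & homeomorphic T M.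

Definition isometric_on (R : realType) (X Y : metricType R) (A : set X)
    (f : X -> Y) : Prop :=
  forall x y, A x -> A y -> mdist (f x) (f y) = mdist x y.

(* X is the one-point extension of A by a; A embeds in it through the
   restriction of e, whose values outside A are irrelevant. *)
Definition one_point_extension_property (R : realType) (U : metricType R) :
    Prop :=
  forall (A : set U) (X : metricType R) (e : U -> X) (a : X),
    finite_set A -> isometric_on A e -> e @` A `|` [set a] = setT ->
    exists2 f : X -> U, isometric_on setT f & forall u, A u -> f (e u) = u.

Definition urysohn_space (R : realType) (U : completeMetricType R) : Prop :=
  separable_space U /\ one_point_extension_property U.

HB.mixin Record isTopologicalGroup G & Topological G & Group G := {
  mulg_continuous : continuous (fun x : G * G => (x.1 * x.2)%g) ;
  invg_continuous : continuous (fun x : G => (x^-1)%g) ;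
}.

#[short(type="topologicalGroupType")]
HB.structure Definition TopologicalGroup :=
  { G of Topological G & Group G & isTopologicalGroup G }.

(* A multiplicative map between groups preserves 1 and inverses. *)
Definition topological_group_embedding (G H : topologicalGroupType)
    (phi : {multiplicative G -> H}) : Prop :=
  injective phi /\
  forall V : set G, open V <-> exists2 W : set H, open W & phi @^-1` W = V.

Section Iso.
Local Open Scope ring_scope.
Variables (R : realType) (U : metricType R).

Record Iso := MkIso {
  iso_fun :> U -> U ;
  iso_isometric : forall x y, mdist (iso_fun x) (iso_fun y) = mdist x y ;
  iso_surj : forall y, exists x, iso_fun x = y
}.

HB.instance Definition _ := gen_eqMixin Iso.
HB.instance Definition _ := gen_choiceMixin Iso.

Lemma iso_eq (f g : Iso) : iso_fun f =1 iso_fun g -> f = g.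
Proof.
case: f g => [f fi fs] [g gi gs] /= /funext fg; move: fi fs gi gs.
by rewrite fg => *; congr MkIso; exact: Prop_irrelevance.
Qed.

Definition iso_one : Iso.
Proof. by apply: (@MkIso idfun) => // y; exists y. Defined.

Definition iso_mul (f g : Iso) : Iso.
Proof.
apply: (@MkIso (f \o g)) => [x y|y] /=; first by rewrite !iso_isometric.
by have [z <-] := iso_surj f y; have [x <-] := iso_surj g z; exists x.
Defined.

Definition iso_inv_fun (f : Iso) (y : U) : U := sval (cid (iso_surj f y)).

Lemma iso_inv_funK (f : Iso) : cancel (iso_inv_fun f) f.
Proof. by move=> y; rewrite /iso_inv_fun; case: cid. Qed.

Lemma iso_inj (f : Iso) : injective f.
Proof.
by move=> x y fxy; apply: mdist_positivity; rewrite -(iso_isometric f) fxy mdistxx.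
Qed.

Lemma iso_funK (f : Iso) : cancel f (iso_inv_fun f).
Proof. by move=> x; apply: (@iso_inj f); rewrite iso_inv_funK. Qed.

Definition iso_inv (f : Iso) : Iso.
Proof.
apply: (@MkIso (iso_inv_fun f)) => [x y|y].
  by rewrite -(iso_isometric f) !iso_inv_funK.
by exists (f y); rewrite iso_funK.
Defined.

Lemma iso_mulA : associative iso_mul.
Proof. by move=> f g h; exact: iso_eq. Qed.
Lemma iso_mul1 : left_id iso_one iso_mul.
Proof. by move=> f; exact: iso_eq. Qed.
Lemma iso_1mul : right_id iso_one iso_mul.
Proof. by move=> f; exact: iso_eq. Qed.
Lemma iso_mulV : left_inverse iso_one iso_inv iso_mul.
Proof. by move=> f; apply: iso_eq => x /=; rewrite iso_funK. Qed.
Lemma iso_Vmul : right_inverse iso_one iso_inv iso_mul.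
Proof. by move=> f; apply: iso_eq => x /=; rewrite iso_inv_funK. Qed.

HB.instance Definition _ :=
  isGroup.Build Iso iso_mulA iso_mul1 iso_1mul iso_mulV iso_Vmul.

HB.instance Definition _ := Topological.copy Iso
  (initial_topology (iso_fun : Iso -> {ptws U -> U})).

Lemma iso_cvgP (F : set_system Iso) (f : Iso) : Filter F ->
  F --> f <-> forall x : U, (fun g : Iso => g x) @ F --> f x.
Proof.
move=> FF; split=> [Ff x|Ff A [_ [[B oB <-]] Bf sBA]].
  have cfx : continuous ((fun h : {ptws U -> U} => h x) \o (iso_fun : Iso -> _)).
    move=> g; apply: continuous_comp.
      exact: (@initial_continuous Iso {ptws U -> U} iso_fun).
    exact: (@proj_continuous U (fun=> U) x).
  exact: (cvg_comp _ _ Ff (cfx f)).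
suff Fp : (iso_fun : Iso -> {ptws U -> U}) @ F --> (f : {ptws U -> U}).
  have FB := Fp B (open_nbhs_nbhs (conj oB Bf)).
  exact: (@filterS _ F FF _ _ sBA FB).
apply/cvg_sup => x.
move=> C [_ [[V oV <-]] Vf sVC].
have FV := Ff x V (open_nbhs_nbhs (conj oV Vf)).
exact: (@filterS _ F FF _ _ (fun g Vg => sVC (iso_fun g) Vg) FV).
Qed.

Import metricType_numDomainType.

Lemma iso_mul_continuous : continuous (fun x : Iso * Iso => (x.1 * x.2)%g).
Proof.
move=> [f g]; apply/iso_cvgP => x; apply/cvgrPdist_lt => e e0 /=.
have f1 : (fun h : Iso * Iso => h.1 (g x)) @ (f, g) --> f (g x).
  have /iso_cvgP/(_ (g x)) : (fun h : Iso * Iso => h.1) @ (f, g) --> f.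
    exact: cvg_fst.
  exact.
have g2 : (fun h : Iso * Iso => h.2 x) @ (f, g) --> g x.
  have /iso_cvgP/(_ x) : (fun h : Iso * Iso => h.2) @ (f, g) --> g.
    exact: cvg_snd.
  exact.
have e20 : 0 < e / 2 by rewrite divr_gt0.
move/cvgrPdist_lt : f1 => /(_ _ e20) f1; move/cvgrPdist_lt : g2 => /(_ _ e20).
apply: filterS2 f1 => h f1 g2.
change (mdist (f (g x)) (h.1 (h.2 x)) < e).
rewrite (le_lt_trans (metric_triangle _ (h.1 (g x)) _))// [e]splitr ltrD//.
by rewrite iso_isometric.
Qed.

Lemma iso_inv_continuous : continuous (fun x : Iso => (x^-1)%g).
Proof.
move=> f; apply/(@iso_cvgP _ _ (fmap_filter _ (nbhs_filter (f : Iso)))) => x.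
apply/cvgrPdist_lt => e e0.
have hf : (fun h : Iso => h (iso_inv_fun f x)) @ f --> f (iso_inv_fun f x).
  exact: ((proj1 (@iso_cvgP (nbhs f) f (nbhs_filter (f : Iso)))) (@cvg_id _ (nbhs f))).
move/cvgrPdist_lt : hf => /(_ _ e0); apply: filterS => h.
rewrite iso_inv_funK metric_sym => hx.
change (mdist (iso_inv_fun f x) (iso_inv_fun h x) < e).
by rewrite -(iso_isometric h) iso_inv_funK.
Qed.

HB.instance Definition _ :=
  isTopologicalGroup.Build Iso iso_mul_continuous iso_inv_continuous.

End Iso.

(* Reduced words in x_0, x_1, ...; (n, true) encodes x_n, (n, false) its
   inverse. *)
Section FreeGroup.

Definition letter : Type := (nat * bool)%type.

Definition letter_inv (a : letter) : letter := (a.1, ~~ a.2).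

Definition reduced (w : seq letter) : bool :=
  sorted (fun a b => b != letter_inv a) w.

Record free_group := FreeWord {
  free_word :> seq letter ;
  free_word_reduced : reduced free_word
}.

HB.instance Definition _ := [isSub for free_word].
HB.instance Definition _ := [Choice of free_group by <:].

(* The reduced form of a :: w, for w reduced. *)
Definition letter_mul (a : letter) (w : seq letter) : seq letter :=
  if w is b :: w' then if b == letter_inv a then w' else a :: w else [:: a].

Definition word_mul (v w : seq letter) : seq letter := foldr letter_mul w v.

Definition word_inv (w : seq letter) : seq letter := rev (map letter_inv w).

Lemma letter_invK : involutive letter_inv.
Proof. by case=> n b; rewrite /letter_inv/= negbK. Qed.

Lemma letter_mul_reduced a w : reduced w -> reduced (letter_mul a w).
Proof.
case: w => [//|b w] rw /=; case: ifPn => [_|ba]; first exact: path_sorted rw.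
by rewrite /reduced/= ba.
Qed.

Lemma word_mul_reduced v w : reduced w -> reduced (word_mul v w).
Proof. by move=> rw; elim: v => //= a v; exact: letter_mul_reduced. Qed.

Lemma letter_mulK a w :
  reduced w -> letter_mul a (letter_mul (letter_inv a) w) = w.
Proof.
case: w => [|b w] /= rw; first by rewrite eqxx.
rewrite letter_invK; case: eqVneq => [ba|_]; last by rewrite /= eqxx.
subst b; case: w rw => [//|c w] /=.
by rewrite /reduced/= => /andP[/negbTE ->].
Qed.

Lemma word_mul_letter a v w :
  reduced w -> word_mul (letter_mul a v) w = letter_mul a (word_mul v w).
Proof.
case: v => [//|b v] rw /=; case: eqVneq => [->|//].
by rewrite letter_mulK// word_mul_reduced.
Qed.

Lemma word_mulA u v w :
  reduced w -> word_mul u (word_mul v w) = word_mul (word_mul u v) w.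
Proof. by move=> rw; elim: u => //= a u ->; rewrite word_mul_letter. Qed.

Lemma word_mulw1 w : reduced w -> word_mul w [::] = w.
Proof.
elim: w => //= a w IH rw; rewrite (IH (path_sorted rw)).
by case: w rw {IH} => [//|b w] /=; rewrite /reduced/= => /andP[/negbTE ->].
Qed.

Lemma word_mulVw w : word_mul (word_inv w) w = [::].
Proof.
elim: w => //= a w IH.
by rewrite /word_inv/= rev_cons /word_mul foldr_rcons/= letter_invK eqxx.
Qed.

Lemma word_invK : involutive word_inv.
Proof.
by move=> w; rewrite /word_inv map_rev revK mapK//; exact: letter_invK.
Qed.

Lemma word_inv_reduced w : reduced w -> reduced (word_inv w).
Proof.
rewrite /word_inv /reduced rev_sorted sorted_map.
apply: sub_sorted => a b /=; apply: contra => /eqP.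
by rewrite letter_invK => ->.
Qed.

Definition free_one : free_group := @FreeWord [::] isT.
Definition free_mul (v w : free_group) : free_group :=
  FreeWord (word_mul_reduced v (free_word_reduced w)).
Definition free_inv (w : free_group) : free_group :=
  FreeWord (word_inv_reduced (free_word_reduced w)).

Lemma free_mulA : associative free_mul.
Proof.
by move=> u v w; apply: val_inj; exact/word_mulA/free_word_reduced.
Qed.
Lemma free_mul1 : left_id free_one free_mul.
Proof. by move=> w; exact: val_inj. Qed.
Lemma free_1mul : right_id free_one free_mul.
Proof. by move=> w; apply: val_inj; exact/word_mulw1/free_word_reduced. Qed.
Lemma free_mulV : left_inverse free_one free_inv free_mul.
Proof. by move=> w; apply: val_inj; exact: word_mulVw. Qed.
Lemma free_Vmul : right_inverse free_one free_inv free_mul.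
Proof.
by move=> w; apply: val_inj; rewrite /= -{1}(word_invK w) word_mulVw.
Qed.

HB.instance Definition _ := isGroup.Build free_group
  free_mulA free_mul1 free_1mul free_mulV free_Vmul.

End FreeGroup.

Section ClosedSubgroups.
Variable G : topologicalGroupType.

Definition free_hom : Type := {multiplicative free_group -> G}.

HB.instance Definition _ := gen_eqMixin free_hom.
HB.instance Definition _ := gen_choiceMixin free_hom.
HB.instance Definition _ := Topological.copy free_hom
  (initial_topology
    ((fun tau : free_hom => tau : free_group -> G) :
      free_hom -> {ptws free_group -> G})).

Record closed_subgroup := ClosedSubgroup {
  closed_subgroup_set :> set G ;
  closed_subgroup_group : group_closed (mem closed_subgroup_set) ;
  closed_subgroup_closed : closed closed_subgroup_set
}.

HB.instance Definition _ := gen_eqMixin closed_subgroup.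
HB.instance Definition _ := gen_choiceMixin closed_subgroup.

Lemma closure_range_group (tau : free_hom) :
  group_closed (mem (closure (range tau))).
Proof.
split=> [|x y /set_mem xS /set_mem yS]; apply/mem_set.
  apply: subset_closure; exists 1%g => //.
  by apply: (mulgI (tau 1%g)); rewrite -gmulfM !mulg1.
have cxy : continuous (fun p : G * G => (p.1 / p.2)%g).
  move=> p; apply: (@continuous_comp _ _ _ (fun p : G * G => (p.1, p.2^-1)%g)
    (fun p : G * G => (p.1 * p.2)%g)); last exact: mulg_continuous.
  apply: cvg_pair; first exact: cvg_fst.
  by apply: continuous_comp; [exact: cvg_snd|exact: invg_continuous].
move=> B /(cxy (x, y)) [[P Q] /= [Px Qy] PQB].
have [_ [[u _ <-] Pu]] := xS _ Px; have [_ [[v _ <-] Qv]] := yS _ Qy.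
exists (tau u / tau v)%g; split; last exact: (PQB (tau u, tau v)).
exists (u / v)%g => //; apply: (mulIg (tau v)).
by rewrite -gmulfM !mulgVK.
Qed.

Definition closure_range (tau : free_hom) : closed_subgroup :=
  ClosedSubgroup (closure_range_group tau) (@closed_closure _ _).

(* When G is separable and metrizable, as Iso U is for U separable,
   [closure_range] is surjective and this is the quotient topology. *)
Definition subgroup_open (W : set closed_subgroup) : Prop :=
  open (closure_range @^-1` W).

Lemma subgroup_openT : subgroup_open setT.
Proof. by rewrite /subgroup_open preimage_setT; exact: openT. Qed.
Lemma subgroup_openI : setI_closed subgroup_open.
Proof. by move=> V W; rewrite /subgroup_open preimage_setI; exact: openI. Qed.
Lemma subgroup_open_bigU (I : Type) (W : I -> set closed_subgroup) :
  (forall i, subgroup_open (W i)) -> subgroup_open (\bigcup_i W i).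
Proof.
move=> oW; rewrite /subgroup_open preimage_bigcup.
by apply: bigcup_open => i _; exact: oW.
Qed.

HB.instance Definition _ := isOpenTopological.Build closed_subgroup
  subgroup_openT subgroup_openI subgroup_open_bigU.

End ClosedSubgroups.

Definition directed (D : Type) (le : D -> D -> Prop) : Prop :=
  [/\ inhabited D, forall i, le i i,
      forall i j k, le i j -> le j k -> le i k &
      forall i j, exists k, le i k /\ le j k].

(* A net converges when its image of this filter does. *)
Definition tails (D : Type) (le : D -> D -> Prop) : set_system D :=
  filter_from setT (fun i => [set j | le i j]).

(* Main.v *)
Require Import Defs.
From HB Require Import structures.
From mathcomp Require Import all_boot all_order all_algebra all_fingroup.
From mathcomp Require Import all_classical all_reals all_analysis.
From mathcomp Require Import lra.

Set Implicit Arguments.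
Unset Strict Implicit.
Unset Printing Implicit Defensive.

Import Order.TTheory GRing.Theory Num.Theory.
Import metricType_numDomainType.

Local Open Scope classical_set_scope.
Local Open Scope ring_scope.

(** Since phi G is a Polish subgroup of Iso U, it is closed, by the Baire
    category theorem (polish_range_closed). Being separable, it is the closure
    of the range of a homomorphism tau from the free group to Iso U
    (dense_free_hom). The map that sends a homomorphism to the closure of its
    range is continuous, by definition of the quotient topology; so it is enough
    to approximate tau by homomorphisms with finite range, that is, to show that
    such homomorphisms are dense (finite_range_approximation). The net is then
    indexed by the neighbourhoods of tau.

    This density is the heart of the matter. Let finitely many isometries g i of
    U and a finite subset A of U be given. Words in the g i of bounded length
    move A inside a finite set, on which every g i is a partial injection that
    extends to a permutation. In the finite group Gam of all permutations of
    that set, the value of a short word at these permutations is trivial only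
    if the word fixes A pointwise (short_words_finite_group).
    On the product of Gam and A there is a left invariant pseudometric that
    extends the metric of A and for which the translation by the image of g i
    almost agrees with g i (finite_equivariant_model): it is the infimum, over
    the words joining the two Gam-components, of the distance in U corrected by
    a small toll per letter, the toll preventing long words, of which nothing is
    known, from shortening the distances within A. The finite pseudometric space
    is realized in U over A (pseudometric_realized). There remains to extend the
    action of Gam from this finite set to U. The extension property of U allows
    one to add the orbits of the points of a dense sequence one at a time
    (equivariant_point), and then the action extends by completeness
    (equivariant_action). *)

(** * Finite metric data in the Urysohn space *)

(** If f takes the value 0 at a point of A, that point already works. Otherwise
    adjoining to A an extra point at distance f a from each a gives a genuine
    metric space, to which the one-point extension property applies. *)
Lemma katetov_realized (R : realType) (U : metricType R) (A : set U)
    (f : U -> R) :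
  one_point_extension_property U -> finite_set A ->
  (forall a b, A a -> A b ->
     f a <= mdist a b + f b /\ mdist a b <= f a + f b) ->
  exists u, forall a, A a -> mdist u a = f a.
Proof.
move=> extU finA Kf.
have [[a0 Aa0 fa0]|fN0] := pselect (exists2 a, A a & f a = 0).
  exists a0 => a Aa; have [] := Kf a0 a Aa0 Aa.
  by have [] := Kf a a0 Aa Aa0; rewrite fa0 metric_sym; lra.
pose D (x y : option (set_type A)) : R :=
  match x, y with
  | Some a, Some b => mdist (val a) (val b)
  | Some a, None | None, Some a => f (val a)
  | None, None => 0
  end.
have Av (a : set_type A) : A (val a) by exact/set_mem/(valP a).
have D0 x : D x x = 0 by case: x => //= a; rewrite mdistxx.
have Dpos x y : D x y = 0 -> x = y.
  case: x y => [a|] [b|] //=; last 2 first.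
  - by move=> fa; exfalso; apply: fN0; exists (val a).
  - by move=> fa; exfalso; apply: fN0; exists (val b).
  by move/mdist_positivity => ab; congr Some; exact: val_inj.
have Dsym x y : D x y = D y x.
  by case: x y => [a|] [b|] //=; rewrite metric_sym.
have Dtri y x z : D x z <= D x y + D y z.
  case: x y z => [a|] [b|] [c|] //=; rewrite ?addr0 ?add0r //.
  - exact: metric_triangle.
  - by have [] := Kf _ _ (Av a) (Av b).
  - by have [] := Kf _ _ (Av a) (Av c).
  - by have [] := Kf _ _ (Av c) (Av b); rewrite metric_sym addrC.
  - by have [] := Kf _ _ (Av b) (Av b); rewrite mdistxx.
pose X : metricType R := HB.pack (option (set_type A))
  (isMetric.Build R (option (set_type A)) D0 Dpos Dsym Dtri).
pose e (u : U) : X :=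
  if pselect (A u) is left Au then Some (SigSub (mem_set Au)) else None.
have eE u (Au : A u) : e u = Some (SigSub (mem_set Au)).
  by rewrite /e; case: pselect => // Au2; congr Some; exact: val_inj.
have isoe : isometric_on A e by move=> u v Au Av'; rewrite (eE u Au) (eE v Av').
have cov : e @` A `|` [set (None : X)] = setT.
  apply/seteqP; split=> // -[a|] _; [left|by right].
  exists (val a) => //; rewrite (eE _ (Av a)); congr Some; exact: val_inj.
have [g isog gK] := extU A X e None finA isoe cov.
exists (g None) => a Aa; rewrite -{1}(gK a Aa) isog// (eE a Aa) //.
Qed.

(** Points are added one at a time: the distances to the points already placed
    satisfy the triangle inequalities, hence form a Katetov function. *)
Lemma pseudometric_realized (R : realType) (U : metricType R) (T : finType)
    (D : T -> T -> R) (S : {set T}) (f : T -> U) :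
  one_point_extension_property U ->
  (forall x, D x x = 0) -> (forall x y, D x y = D y x) ->
  (forall x y z, D x z <= D x y + D y z) ->
  {in S &, forall x y, mdist (f x) (f y) = D x y} ->
  exists2 g : T -> U, {in S, g =1 f} & forall x y, mdist (g x) (g y) = D x y.
Proof.
move=> extU D0 Dsym Dtri.
have [n] := ubnP #|~: S|; elim: n => // n IHn in S f *; rewrite ltnS => Sn fD.
have [x xS|SC0] := pickP (mem (~: S)); last first.
  have inS x : x \in S by have /= := SC0 x; rewrite !inE => /negbFE.
  by exists f => // x y; exact: fD.
(* D need not separate points, so f may identify elements of S; F takes the
   distance to x from any of the elements above u. *)
pose F (u : U) : R := if [pick s in S | f s == u] is Some s then D x s else 0.
have FE s : s \in S -> F (f s) = D x s.
  move=> sS; rewrite /F.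
  case: pickP => [t /andP[tS /eqP fts]|/(_ s)]; last first.
    by rewrite sS eqxx.
  have ts0 : D t s = 0 by rewrite -fD// fts mdistxx.
  have := Dtri x t s; have := Dtri x s t; rewrite (Dsym s t) ts0; lra.
have [|a b [s sS <-] [t tS <-]|u ufS] :=
  @katetov_realized R U (f @` [set` S]) F extU.
- exact/finite_image/finite_finset.
- rewrite !FE// fD//; split; first by rewrite addrC (Dsym s) Dtri.
  by rewrite (Dsym x s) Dtri.
have fxu s : s \in S -> mdist u (f s) = D x s.
  by move=> sS; rewrite ufS ?FE//; exists s.
pose f' y := if y == x then u else f y.
have xNS s : s \in S -> (s == x) = false.
  by move=> sS; apply: contraTF sS => /eqP ->; move: xS; rewrite !inE.
have [||g gf' gD] := IHn (x |: S) f'.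
- apply: leq_trans Sn; apply: proper_card; apply/fintype.properP; split.
    by apply/fintype.subsetP => y; rewrite !inE negb_or => /andP[].
  by exists x => //; rewrite !inE eqxx.
- move=> y z; rewrite !in_setU1 /f'.
  case: eqVneq => [->|_] /=; case: eqVneq => [->|_] //= yS zS.
  + by rewrite mdistxx D0.
  + exact: fxu.
  + by rewrite metric_sym fxu.
  + exact: fD.
exists g => // s sS; rewrite gf' ?in_setU1 ?sS ?orbT// /f' xNS//.
Qed.

(** * Equivariant families of orbits *)

Section Equivariant.
Variables (R : realType) (U : metricType R) (Gam : finGroupType).
Implicit Types (K : set (Gam -> U)) (S : seq (Gam -> U)).

(** A map from the group to U stands for the orbit of its value at 1; members
    of an equivariant family move together under left translations, by
    isometries of the union of their ranges. *)
Definition equivariant K : Prop :=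
  forall p q, K p -> K q -> forall c a b,
    mdist (p (c * a)%g) (q (c * b)%g) = mdist (p a) (q b).

(** The new orbit is described by Kuratowski's embedding: a point t of the old
    or the new orbits is encoded by the function k t of its distances to the
    points of the old orbits, a translate of u having the translated function.
    The sup distance of these functions is an invariant pseudometric that
    extends the given distances, also when u lies in an old orbit. *)
Lemma equivariant_point S (u : U) :
  one_point_extension_property U -> equivariant [set` S] ->
  exists2 p, p 1%g = u & equivariant [set` p :: S].
Proof.
move=> extU eqS.
pose T : finType := (Gam * option (seq_sub S))%type.
pose k (t : T) (x : Gam * seq_sub S) : R :=
  match t.2 with
  | Some i => mdist (val i t.1) (val x.2 x.1)
  | None => mdist u (val x.2 (t.1^-1 * x.1)%g)
  end.
have Sv (i : seq_sub S) : [set` S] (val i) by exact: (valP i).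
have kinv c t x : k ((c * t.1)%g, t.2) ((c * x.1)%g, x.2) = k t x.
  case: t x => [a [i|]] [b j]; rewrite /k/=.
    exact: (eqS _ _ (Sv i) (Sv j)).
  by rewrite invMg -mulgA mulKg.
pose D s t : R := \big[Num.max/0]_x `|k s x - k t x|.
have leD s t x : `|k s x - k t x| <= D s t.
  exact: (le_bigmax _ (fun x => `|k s x - k t x|)).
have Dle s t r : 0 <= r -> (forall x, `|k s x - k t x| <= r) -> D s t <= r.
  move=> r0 H; rewrite /D; apply: bigmax_le => // x _; exact: H.
have D_ge0 s t : 0 <= D s t by exact: bigmax_ge_id.
have D0 s : D s s = 0.
  by apply/eqP; rewrite eq_le D_ge0 andbT Dle// => x; rewrite subrr normr0.
have Dsym s t : D s t = D t s.
  by apply: eq_bigr => x _; rewrite distrC.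
have Dtri s t r : D s r <= D s t + D t r.
  apply: Dle => [|x]; first exact: addr_ge0.
  rewrite -(subrKA (k t x)) (le_trans (ler_normD _ _))// lerD//.
have Dinv c s t : D ((c * s.1)%g, s.2) ((c * t.1)%g, t.2) = D s t.
  suff H d s' t' : D s' t' <= D ((d * s'.1)%g, s'.2) ((d * t'.1)%g, t'.2).
    apply/eqP; rewrite eq_le H andbT.
    have := H (c^-1)%g ((c * s.1)%g, s.2) ((c * t.1)%g, t.2).
    by rewrite /= !mulKg -!surjective_pairing.
  apply: Dle => // x; rewrite -(kinv d s') -(kinv d t'); exact: leD.
(* The sup defining D s t, for t in an old orbit, is attained at t itself. *)
have kD s a (i : seq_sub S) : D s (a, Some i) = k s (a, i).
  have kge0 : 0 <= k s (a, i) by rewrite /k; case: s.2 => *; exact: mdist_ge0.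
  apply/eqP; rewrite eq_le; apply/andP; split; last first.
    have := leD s (a, Some i) (a, i).
    by rewrite {2}/k/= mdistxx subr0 ger0_norm.
  apply: Dle => // -[b j]; rewrite ler_norml; rewrite /k/=.
  case: s {kge0} => [c [l|]] /=.
    have := metric_triangle (val l c) (val i a) (val j b).
    have := metric_triangle (val i a) (val l c) (val j b).
    by rewrite (metric_sym (val i a) (val l c)); lra.
  rewrite -(eqS _ _ (Sv i) (Sv j) (c^-1)%g a b).
  set v := val i _; set w := val j _.
  have := metric_triangle u v w; have := metric_triangle v u w.
  by rewrite (metric_sym v u); lra.
(* The element 1 of the new orbit is already placed, at u. *)
pose f (t : T) : U := if t.2 is Some i then val i t.1 else u.
pose A : {set T} := finset (fun t => (t.2 != None) || (t.1 == 1%g)).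
have [|g gf gD] := @pseudometric_realized R U T D A f extU D0 Dsym Dtri.
  move=> [a [i|]] [b [j|]]; rewrite !inE /f/= => sA tA.
  - by rewrite kD.
  - by rewrite Dsym kD /k/= (eqP tA) invg1 mul1g metric_sym.
  - by rewrite kD /k/= (eqP sA) invg1 mul1g.
  - by rewrite (eqP sA) (eqP tA) D0 mdistxx.
exists (fun a => g (a, None)); first by rewrite gf// inE /= eqxx.
have gE p : [set` (fun a => g (a, None)) :: S] p ->
    exists o, p = fun a => g (a, o).
  rewrite /= inE => /orP[/eqP ->|pS]; first by exists None.
  by exists (Some (SeqSub pS)); apply/funext => a; rewrite gf// inE.
move=> p q /gE[r ->] /gE[r2 ->] c a b.
by rewrite !gD -(Dinv c (a, r)).
Qed.

(** Adding one orbit after the other, an equivariant family comes to meet every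
    term of a sequence, for instance of a dense one. *)
Lemma equivariant_sequence S (u : nat -> U) :
  one_point_extension_property U -> equivariant [set` S] ->
  exists2 K, [set` S] `<=` K /\ equivariant K &
    forall n, exists2 p, K p & p 1%g = u n.
Proof.
move=> extU eqS.
have /choice[F FP] : forall x : seq (Gam -> U) * U, exists p,
    equivariant [set` x.1] -> p 1%g = x.2 /\ equivariant [set` p :: x.1].
  move=> [Q v]; have [eqQ|] := pselect (equivariant [set` Q]); last first.
    by exists (fun=> v).
  by have [p p1 pQ] := equivariant_point v extU eqQ; exists p.
pose Q := fix Q n := if n is m.+1 then F (Q m, u m) :: Q m else S.
have eqQ n : equivariant [set` Q n].
  by elim: n => //= n IH; have [] := FP (Q n, u n) IH.
have QS m n : (m <= n)%N -> [set` Q m] `<=` [set` Q n].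
  move=> /subnK <-; elim: (n - m)%N => [|d IH] //= p /IH pQ.
  by rewrite /= inE; apply/orP; right.
exists (\bigcup_n [set` Q n]); first split.
- by move=> p pS; exists 0%N.
- move=> p q [m _ pm] [n _ qn]; apply: (eqQ (maxn m n)).
    exact: QS (leq_maxl _ _) _ pm.
  exact: QS (leq_maxr _ _) _ qn.
move=> n; exists (F (Q n, u n)); last by have [] := FP (Q n, u n) (eqQ n).
by exists n.+1 => //=; rewrite inE eqxx.
Qed.

End Equivariant.

(** Left translation by c is an isometry of the union of the orbits, which is
    dense, and extends to U by completeness. The image y of x is characterized
    by its distances to the points of the orbits, and all the algebraic
    identities follow from the uniqueness of such a y. *)
Lemma equivariant_action (R : realType) (U : completeMetricType R)
    (Gam : finGroupType) (K : set (Gam -> U)) :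
  equivariant K ->
  (forall x e, 0 < e -> exists p a, K p /\ mdist x (p a) < e) ->
  exists2 h : Gam -> Iso U, {morph h : c d / (c * d)%g} &
    forall c p a, K p -> h c (p a) = p (c * a)%g.
Proof.
move=> eqK denseK.
have /choice[H HP] : forall cx : Gam * U, exists y, forall p a, K p ->
    mdist y (p (cx.1 * a)%g) = mdist cx.2 (p a).
  move=> [c x] /=.
  (* The sets B e are the translates of the balls of radius e around x, cut
     with the orbits; they generate a Cauchy filter. *)
  pose B e := [set y |
    exists p a, [/\ K p, mdist x (p a) < e & y = p (c * a)%g]].
  pose F := filter_from [set e : R | 0 < e] B.
  have FF : ProperFilter F.
    apply: filter_from_proper => [|e /= e0]; last first.
      by have [p [a [Kp pa]]] := denseK x e e0; exists (p (c * a)%g), p, a.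
    apply: filter_from_filter => [|e f /= e0 f0]; first by exists 1 => /=.
    exists (Num.min e f); rewrite /= ?lt_min ?e0// => y [p [a [Kp]]].
    by rewrite lt_min => /andP[xe xf] ->; split; exists p, a.
  have /cauchy_cvg/cvg_ex[y Fy] : cauchy F.
    apply: cauchy_exP => e e0; have e20 : 0 < e / 2 by rewrite divr_gt0.
    have [p [a [Kp pa]]] := denseK x _ e20.
    exists (p (c * a)%g), (e / 2) => //= z [q [b [Kq qb ->]]].
    rewrite ballEmdist/= eqK// (le_lt_trans (metric_triangle _ x _))//.
    by rewrite (metric_sym _ x) [e]splitr ltrD.
  exists y => p a Kp; apply/eqP; rewrite -subr_eq0 -normr_le0.
  apply/ler_addgt0Pr => e e0; rewrite add0r.
  have e20 : 0 < e / 2 by rewrite divr_gt0.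
  have [f f0 Bf] : F (ball y (e / 2)).
    exact: Fy _ (nbhsx_ballx y _ e20).
  have [|q [b [Kq]]] := denseK x (Num.min f (e / 2)).
    by rewrite lt_min e20 andbT.
  rewrite lt_min => /andP[qf qe].
  have : ball y (e / 2) (q (c * b)%g) by apply: Bf; exists q, b.
  rewrite ballEmdist/= => yq.
  have := eqK _ _ Kq Kp c b a.
  have := metric_triangle y (q (c * b)%g) (p (c * a)%g).
  have := metric_triangle (q (c * b)%g) y (p (c * a)%g).
  have := metric_triangle x (q b) (p a).
  have := metric_triangle (q b) x (p a).
  rewrite (metric_sym (q (c * b)%g) y) (metric_sym (q b) x).
  by rewrite ler_norml; lra.
have uniq y z : (forall p a, K p -> mdist y (p a) = mdist z (p a)) -> y = z.
  move=> yz; apply: mdist_positivity; apply/eqP; rewrite eq_le mdist_ge0 andbT.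
  apply/ler_addgt0Pr => e e0; rewrite add0r.
  have e20 : 0 < e / 2 by rewrite divr_gt0.
  have [p [a [Kp pa]]] := denseK y _ e20.
  rewrite (le_trans (metric_triangle _ (p a) _))// (metric_sym _ z) -yz//.
  by rewrite [e]splitr ltW// ltrD.
have HM c d x : H ((c * d)%g, x) = H (c, H (d, x)).
  apply: uniq => p a Kp.
  rewrite -[a](mulKVg (c * d)%g); set b := (_^-1 * a)%g.
  rewrite (HP ((c * d)%g, x) p b Kp)/= -mulgA (HP (c, H (d, x)) p _ Kp)/=.
  by rewrite (HP (d, x) p b Kp).
have H1 x : H (1%g, x) = x.
  by apply: uniq => p a Kp; rewrite -{1}[a]mul1g HP.
have HK c p a : K p -> H (c, p a) = p (c * a)%g.
  move=> Kp; apply: uniq => q b Kq.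
  by rewrite -{1}[b](mulKVg c) HP//= -(eqK _ _ Kp Kq c) mulKVg.
have Hiso c x y : mdist (H (c, x)) (H (c, y)) = mdist x y.
  have le d u v : mdist (H (d, u)) (H (d, v)) <= mdist u v.
    apply/ler_addgt0Pr => e e0; have e20 : 0 < e / 2 by rewrite divr_gt0.
    have [p [a [Kp pa]]] := denseK v _ e20.
    have := HP (d, u) p a Kp; have := HP (d, v) p a Kp => /= vp up.
    have := metric_triangle (H (d, u)) (p (d * a)%g) (H (d, v)).
    rewrite up (metric_sym (p _)) vp; have := metric_triangle u v (p a); lra.
  apply/eqP; rewrite eq_le le /=; have := le (c^-1)%g (H (c, x)) (H (c, y)).
  by rewrite -!HM mulVg !H1.
have Hsurj c y : exists x, H (c, x) = y.
  by exists (H (c^-1, y)%g); rewrite -HM mulgV H1.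
exists (fun c => MkIso (Hiso c) (Hsurj c)); last by move=> c p a; exact: HK.
by move=> c d; apply: iso_eq => x /=; rewrite HM.
Qed.

(** * Evaluation of words and homomorphisms of the free group *)

Section MulgMorphism.
Variables (G H : groupType) (f : G -> H).
Hypothesis fM : {morph f : x y / (x * y)%g}.

Lemma mulg_morph1 : f 1%g = 1%g.
Proof. by apply: (mulgI (f 1%g)); rewrite -fM !mulg1. Qed.

Lemma mulg_morphV x : f (x^-1)%g = (f x)^-1%g.
Proof. by apply: (mulgI (f x)); rewrite -fM !mulgV mulg_morph1. Qed.

End MulgMorphism.

Section WordEvaluation.
Variable G : groupType.
Implicit Types (c : nat -> G) (v w : seq letter).

Definition letter_ev c (l : letter) : G := if l.2 then c l.1 else (c l.1)^-1%g.

Definition word_ev c w : G := foldr (fun l x => letter_ev c l * x)%g 1%g w.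

Lemma letter_ev_inv c l : letter_ev c (letter_inv l) = (letter_ev c l)^-1%g.
Proof. by case: l => n [] //=; rewrite /letter_ev/= invgK. Qed.

Lemma word_ev_cat c v w : word_ev c (v ++ w) = (word_ev c v * word_ev c w)%g.
Proof. by elim: v => [|l v IH] /=; rewrite ?mul1g// IH mulgA. Qed.

Lemma word_ev_inv c w : word_ev c (word_inv w) = (word_ev c w)^-1%g.
Proof.
elim: w => [|l w IH]; first by rewrite /= invg1.
rewrite /word_inv/= rev_cons -cats1 word_ev_cat -/(word_inv w) IH /=.
by rewrite mulg1 letter_ev_inv invgM.
Qed.

Lemma word_ev_mul c v w :
  word_ev c (word_mul v w) = (word_ev c v * word_ev c w)%g.
Proof.
elim: v => [|l v IH] /=; first by rewrite mul1g.
rewrite -mulgA -IH; case: (word_mul v w) => [//|m u] /=.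
by case: eqVneq => [->|//]; rewrite letter_ev_inv mulVKg.
Qed.

Lemma word_ev_eq c c' w : (forall l, l \in w -> c l.1 = c' l.1) ->
  word_ev c w = word_ev c' w.
Proof.
elim: w => //= l w IH H; rewrite IH => [|m mw]; last first.
  by apply: H; rewrite inE mw orbT.
by rewrite /letter_ev H ?mem_head.
Qed.

Definition free_extension c (w : free_group) : G := word_ev c w.

Lemma free_extensionM c : {morph free_extension c : v w / (v * w)%g}.
Proof. by move=> v w; exact: word_ev_mul. Qed.

HB.instance Definition _ c :=
  isMultiplicative.Build free_group G (free_extension c) (free_extensionM c).

Definition free_gen (n : nat) : free_group := @FreeWord [:: (n, true)] isT.

Lemma free_hom_word (tau : {multiplicative free_group -> G}) (w : free_group) :
  tau w = word_ev (tau \o free_gen) w.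
Proof.
case: w => w; elim: w => [|l w IH] rw /=.
  have -> : FreeWord rw = 1%g by exact: val_inj.
  exact: (@mulg_morph1 _ _ tau (@gmulfM _ _ tau)).
have rw' : reduced w by exact: path_sorted rw.
have rl : reduced [:: l] by [].
rewrite /= -(IH rw').
have -> : FreeWord rw = (FreeWord rl * FreeWord rw')%g.
  apply: val_inj => /=; case: (w) rw {rw' IH} => [//|b u] /=.
  by rewrite /reduced /= => /andP[/negbTE ->].
rewrite gmulfM; congr (_ * _)%g; case: l {rw} rl => n [] rl.
  by congr (tau _); exact: val_inj.
rewrite /letter_ev /= -(@mulg_morphV _ _ tau (@gmulfM _ _ tau)).
by congr (tau _); exact: val_inj.
Qed.

End WordEvaluation.

(** * Finite models of finitely many isometries *)

(** The complements of D and of its image have the same size, so that matching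
    their enumerations completes f to a bijection. *)
Lemma partial_injection_perm (T : finType) (D : {set T}) (f : T -> T) :
  {in D &, injective f} -> exists s : {perm T}, {in D, s =1 f}.
Proof.
move=> injf.
have szE : size (enum (~: D)) = size (enum (~: (f @: D))).
  by rewrite -!cardE [LHS]cardsCs [RHS]cardsCs !finset.setCK card_in_imset.
pose s x := if x \in D then f x
            else nth x (enum (~: (f @: D))) (index x (enum (~: D))).
have sND x : x \notin D -> s x \notin f @: D.
  move=> xD; rewrite /s (negbTE xD) -finset.in_setC -mem_enum mem_nth//.
  by rewrite -szE index_mem mem_enum finset.in_setC.
have s_inj : injective s.
  move=> x y; case: (boolP (x \in D)) => xD; case: (boolP (y \in D)) => yD.
  - by rewrite /s xD yD; exact: injf.
  - by move=> sxy; move: (sND _ yD); rewrite -sxy {1}/s xD imset_f.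
  - by move=> sxy; move: (sND _ xD); rewrite sxy {1}/s yD imset_f.
  have ix z : z \notin D ->
      (index z (enum (~: D)) < size (enum (~: (f @: D))))%N.
    by move=> zD; rewrite -szE index_mem mem_enum finset.in_setC.
  rewrite /s (negbTE xD) (negbTE yD) (set_nth_default x y) ?ix// => /eqP.
  rewrite nth_uniq ?ix ?enum_uniq// => /eqP.
  move=> ixy; rewrite -(@nth_index _ x x (enum (~: D))); last first.
    by rewrite mem_enum finset.in_setC.
  by rewrite ixy nth_index// mem_enum finset.in_setC.
by exists (perm s_inj) => x xD; rewrite permE /s xD.
Qed.

(** On the finite set of points that words of length at most L can reach from
    A, each generator is a partial injection, and so extends to a permutation.
    This is the classical proof that free groups are residually finite.
    Permutations compose in the opposite order, whence the inverses. *)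
Lemma short_words_finite_group (R : realType) (U : metricType R)
    (g : nat -> Iso U) (n L : nat) (A : seq U) :
  (forall i, (n <= i)%N -> g i = 1%g) ->
  exists (Gam : finGroupType) (c : nat -> Gam), forall w, (size w <= L)%N ->
    word_ev c w = 1%g -> {in A, forall a, word_ev g w a = a}.
Proof.
move=> g1.
pose letters : seq letter :=
  [seq (i, b) | i <- iota 0 n, b <- [:: true; false]].
(* X k contains the images of A under the words of length at most k. *)
pose X := fix X k := if k is k'.+1
  then X k' ++ [seq letter_ev g l x | l <- letters, x <- X k'] else A.
have XS k l x : x \in X k -> letter_ev g l x \in X k.+1.
  move=> xX /=; rewrite mem_cat.
  have [ln|nl] := ltnP l.1 n.
    apply/orP; right; apply/allpairsP; exists (l, x); split=> //=.
    apply/allpairsP; exists l.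
    by split=> //=; [rewrite mem_iota|case: (l.2)|case: l {ln}].
  suff -> : letter_ev g l x = x by rewrite xX.
  by rewrite /letter_ev (g1 _ nl) invg1; case: (l.2).
have Xle j k : (j <= k)%N -> {subset X j <= X k}.
  move=> /subnK <-; elim: (k - j)%N => [|d IH] //= x /IH xX.
  by rewrite /= mem_cat xX.
pose T : finType := seq_sub (X L).
have /choice[s sP] : forall i, exists s : {perm T}, forall x y : T,
    val y = g i (val x) -> s x = y.
  move=> i; pose f (x : T) : T := insubd x (g i (val x)).
  have [|s sf] :=
      @partial_injection_perm T (finset (fun x => g i (val x) \in X L)) f.
    move=> x y; rewrite !inE => gx gy /(congr1 val).
    rewrite !val_insubd gx gy => /iso_inj; exact: val_inj.
  exists s => x y yx; rewrite sf ?inE -?yx ?(valP y)//.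
  by apply: val_inj; rewrite val_insubd -yx (valP y).
exists {perm T}, (fun i => (s i)^-1)%g.
have evP w : (size w <= L)%N -> forall x : T, val x \in A ->
    exists2 y : T, val y = word_ev g w (val x) &
      (word_ev (fun i => (s i)^-1)%g w)^-1%g x = y /\ val y \in X (size w).
  elim: w => [|l w IH] wL x xA; first by exists x => //=; rewrite invg1 perm1.
  have [y' yE [ey yX]] := IH (ltnW wL) x xA.
  have lX := XS _ l _ yX.
  exists (SeqSub (Xle _ _ wL _ lX)) => /=; first by rewrite yE.
  split=> //; rewrite invgM permM ey.
  case: l wL lX => i [] wL lX; rewrite /letter_ev/= ?invgK; first exact: sP.
  apply: (canLR (permK _)); apply/esym; apply: sP => /=.
  by rewrite -[RHS]/((g i * (g i)^-1)%g (ssval y')) mulgV.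
move=> w wL w1 a aA.
have aX : a \in X L by exact: (Xle 0%N).
by have [y /= <- [<- _]] := evP w wL (SeqSub aX) aA; rewrite w1 invg1 perm1.
Qed.

(** Take the finite group Gam of short_words_finite_group for a large L. Up to
    the cap M, the distance of (d, a) and (e, b) in Gam * A is the infimum, over
    the words w with d * w = e in Gam, of the distance in U from a to the
    g-image of b under w, plus a toll eta for each letter of w. This is a
    pseudometric, invariant under left translations of Gam. It induces on
    {1} * A the distance of U, because a word w trivial in Gam is either long,
    and then its toll exceeds the diameter of A, or short, and then it fixes A
    pointwise. Finally it is small between a translate by w and the true image
    under w, by the very choice of w. *)
Lemma finite_equivariant_model (R : realType) (U : metricType R)
    (g : nat -> Iso U) (n : nat) (A : seq U) (eta : R) :
  one_point_extension_property U ->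
  (forall i, (n <= i)%N -> g i = 1%g) -> 0 < eta ->
  exists (Gam : finGroupType) (c : nat -> Gam) (P : U -> Gam -> U),
    [/\ equivariant [set` map P A], {in A, forall a, P a 1%g = a} &
        forall w, {in A &, forall a b,
          mdist a (P b (word_ev c w)) <=
            mdist a (word_ev g w b) + eta *+ size w}].
Proof.
move=> extU g1 eta0.
pose M : R := \big[Num.max/0]_(x <- A) \big[Num.max/0]_(y <- A) mdist x y.
have M0 : 0 <= M by exact: bigmax_ge_id.
have dM : {in A &, forall a b, mdist a b <= M}.
  move=> a b aA bA.
  apply: le_trans (le_bigmax_seq 0 a xpredT
    (fun x => \big[Num.max/0]_(y <- A) mdist x y) aA isT).
  exact: (le_bigmax_seq 0 b xpredT (mdist a)).
pose L := Num.bound (M / eta).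
have ML k : (L < k)%N -> M <= eta *+ k.
  move=> Lk; rewrite -mulr_natr mulrC -ler_pdivrMr//.
  rewrite (le_trans (ltW (archi_boundP _)))//; first by rewrite divr_ge0// ltW.
  by rewrite ler_nat ltnW.
have [Gam [c cP]] := @short_words_finite_group R U g n L A g1.
pose T : finType := (Gam * seq_sub A)%type.
have TA (t : T) : val t.2 \in A by exact: (valP t.2).
pose E (s t : T) : set R := [set r | r = M \/
  exists2 w, (s.1 * word_ev c w)%g = t.1 &
    r = mdist (val s.2) (word_ev g w (val t.2)) + eta *+ size w].
have E0 s t : lbound (E s t) 0.
  move=> r [->//|[w _ ->]]; rewrite addr_ge0 ?mdist_ge0// mulrn_wge0// ltW//.
have En0 s t : E s t !=set0 by exists M; left.
pose D s t := inf (E s t).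
have Dle s t r : E s t r -> D s t <= r.
  by move=> Er; apply: ge_inf => //; exists 0; exact: E0.
have Dge s t r : (forall x, E s t x -> r <= x) -> r <= D s t.
  by move=> H; apply: lb_le_inf.
have D_ge0 s t : 0 <= D s t by apply: Dge => x; exact: E0.
have D0 s : D s s = 0.
  apply/eqP; rewrite eq_le D_ge0 andbT; apply: Dle; right; exists [::] => /=.
    by rewrite mulg1.
  by rewrite mdistxx addr0.
have Dsym_le s t : D s t <= D t s.
  apply: Dge => r [->|[w tws ->]]; apply: Dle; [by left|right].
  exists (word_inv w); first by rewrite word_ev_inv -tws mulgK.
  rewrite word_ev_inv /word_inv size_rev size_map; congr (_ + _).
  rewrite -[LHS](iso_isometric (word_ev g w)^-1%g) [LHS]metric_sym.
  congr (mdist _ _).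
  rewrite -[LHS]/(((word_ev g w)^-1 * word_ev g w)%g (val s.2)).
  by rewrite mulVg.
have Dsym s t : D s t = D t s by apply/eqP; rewrite eq_le !Dsym_le.
have Dtri s t r : D s r <= D s t + D t r.
  rewrite -lerBlDr; apply: (Dge) => x Ex; rewrite lerBlDr addrC -lerBlDr.
  apply: Dge => y Ey; rewrite lerBlDr addrC.
  have x0 := E0 _ _ _ Ex; have y0 := E0 _ _ _ Ey.
  case: Ex x0 => [->|[v sv ->]] x0.
    by apply: (@le_trans _ _ M); [apply: Dle; left|rewrite lerDl].
  case: Ey y0 => [->|[w tw ->]] y0.
    by apply: (@le_trans _ _ M); [apply: Dle; left|rewrite lerDr].
  apply: (@le_trans _ _ (mdist (val s.2) (word_ev g (v ++ w) (val r.2)) +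
      eta *+ size (v ++ w))).
    by apply: Dle; right; exists (v ++ w) => //; rewrite word_ev_cat mulgA sv.
  rewrite size_cat mulrnDr addrACA lerD2r word_ev_cat.
  rewrite (le_trans (metric_triangle _ (word_ev g v (val t.2)) _))// lerD2l.
  by rewrite /= iso_isometric.
have Dinv d s t : D ((d * s.1)%g, s.2) ((d * t.1)%g, t.2) = D s t.
  rewrite /D; congr inf; apply/seteqP; split=> r [->|[w sw ->]];
    (try by left); right; exists w => //=; move: sw => /=.
    by rewrite -mulgA => /mulgI.
  by rewrite -mulgA => ->.
have D1 (a b : seq_sub A) : D (1%g, a) (1%g, b) = mdist (val a) (val b).
  apply/eqP; rewrite eq_le; apply/andP; split.
    by apply: Dle; right; exists [::]; rewrite /= ?mulg1 ?addr0.
  apply: Dge => r [->|[w /= w1 ->]]; first by apply: dM; exact: valP.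
  have [wL|Lw] := leqP (size w) L.
    rewrite (cP w wL _ _ (valP b)) ?lerDl ?mulrn_wge0 ?ltW//.
    by rewrite -[LHS]mul1g.
  rewrite (le_trans _ (_ : M <= _))//; first by apply: dM; exact: valP.
  by rewrite (le_trans (ML _ Lw))// lerDr mdist_ge0.
have [|f fA fD] := @pseudometric_realized R U T D
    (finset (fun t : T => t.1 == 1%g)) (fun t => val t.2) extU D0 Dsym Dtri.
  by move=> [d a] [e b]; rewrite !inE /= => /eqP -> /eqP ->; rewrite D1.
pose P (a : U) (d : Gam) : U := if insub a is Some a' then f (d, a') else a.
have PE (a : seq_sub A) d : P (val a) d = f (d, a) by rewrite /P valK.
exists Gam, c, P; split.
- move=> p q /mapP[a aA ->] /mapP[b bA ->] d d1 d2.
  rewrite !(PE (SeqSub aA)) !(PE (SeqSub bA)) !fD.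
  exact: (Dinv d (d1, _) (d2, _)).
- by move=> a aA; rewrite (PE (SeqSub aA)) fA// inE.
move=> w a b aA bA; rewrite (PE (SeqSub bA)).
have {1}-> : a = f (1%g, SeqSub aA) by rewrite fA// inE.
by rewrite fD; apply: Dle; right; exists w => //=; rewrite mul1g.
Qed.

(** * Density of the homomorphisms with finite range *)

Lemma separable_sequence (T : topologicalType) (t0 : T) :
  separable_space T ->
  exists u : nat -> T, forall V : set T, open V -> V !=set0 ->
    exists n, V (u n).
Proof.
move=> [D /countable_injP[f injf] denseD].
have /choice[u uP] : forall n, exists x, (exists2 y, D y & f y = n) ->
    D x /\ f x = n.
  move=> n; have [[y Dy fy]|] := pselect (exists2 y, D y & f y = n).
    by exists y.
  by exists t0.
exists u => V oV V0; have [x [Vx Dx]] := denseD V V0 oV.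
exists (f x); have [|Du fu] := uP (f x); first by exists x.
by rewrite (injf _ _ _ _ fu) ?inE.
Qed.

Lemma word_ev_morph (G H : groupType) (h : G -> H) (c : nat -> G) w :
  {morph h : x y / (x * y)%g} -> word_ev (h \o c) w = h (word_ev c w).
Proof.
move=> hM; elim: w => [|[n b] w IH] /=; first by rewrite (mulg_morph1 hM).
by rewrite hM IH /letter_ev; case: b => //=; rewrite (mulg_morphV hM).
Qed.

Lemma iso_cvg (R : realType) (U : metricType R) (T : Type) (F : set_system T)
    (FF : Filter F) (k : T -> Iso U) (f : Iso U) :
  (forall x e, 0 < e -> F [set t | mdist (k t x) (f x) < e]) -> k @ F --> f.
Proof.
move=> H; apply/iso_cvgP => x; apply/cvgrPdist_lt => e e0.
apply: (@filterS _ F FF _ _ _ (H x e e0)) => t /=.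
by rewrite metric_sym.
Qed.

Lemma free_hom_cvg (G : topologicalGroupType) (F : set_system (free_hom G))
    (FF : Filter F) (tau : free_hom G) :
  (forall w, (fun sg : free_hom G => sg w) @ F --> tau w) -> F --> tau.
Proof.
move=> Fw A [_ [[B oB <-]] Bf sBA].
suff Fp : (fun sg : free_hom G => (sg : {ptws free_group -> G})) @ F -->
    (tau : {ptws free_group -> G}).
  have FB := Fp B (open_nbhs_nbhs (conj oB Bf)).
  exact: (@filterS _ F FF _ _ sBA FB).
apply/cvg_sup => w C [_ [[V oV <-]] Vf sVC].
have FV := Fw w V (open_nbhs_nbhs (conj oV Vf)).
exact: (@filterS _ F FF _ _ (fun g Vg => sVC _ Vg) FV).
Qed.

Lemma free_hom_nbhs (R : realType) (U : metricType R)
    (tau : free_hom (Iso U)) (V : set (free_hom (Iso U))) :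
  nbhs tau V ->
  exists (W : seq free_group) (S : seq U) (e : R), 0 < e /\
    forall sg : free_hom (Iso U),
      (forall w x, w \in W -> x \in S -> mdist (sg w x) (tau w x) < e) -> V sg.
Proof.
pose B (i : seq free_group * seq U * R) := [set sg : free_hom (Iso U) |
  forall w x, w \in i.1.1 -> x \in i.1.2 -> mdist (sg w x) (tau w x) < i.2].
pose F := filter_from [set i : seq free_group * seq U * R | 0 < i.2] B.
have FF : Filter F.
  apply: filter_from_filter => [|[[W S] e] [[W' S'] e'] /= e0 e'0].
    by exists ([::], [::], 1) => /=.
  exists (W ++ W', S ++ S', Num.min e e'); first by rewrite /= lt_min e0.
  move=> sg /= sgB; split=> w x /= wW xS; have := sgB w x;
    by rewrite !mem_cat wW xS ?orbT lt_min => /(_ isT isT)/andP[].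
have Ftau : F --> tau.
  apply: free_hom_cvg => w; apply: iso_cvg => x e e0.
  exists ([:: w], [:: x], e) => //= sg /= sgB.
  by apply: sgB; rewrite mem_head.
by move=> /Ftau [[[W S] e] /= e0 BV]; exists W, S, e.
Qed.

(** A neighbourhood of tau involves only finitely many words and points. On
    these, tau is approximated within eta per letter by the translations of a
    finite group, acting on finitely many orbits; adding orbits through a dense
    sequence extends the action of this group to the whole of U. *)
Lemma finite_range_approximation (R : realType) (U : completeMetricType R)
    (tau : free_hom (Iso U)) (V : set (free_hom (Iso U))) :
  urysohn_space U -> nbhs tau V ->
  exists2 sg : free_hom (Iso U), V sg & finite_set (range sg).
Proof.
move=> [sepU extU] /free_hom_nbhs[W [S [e [e0 WSV]]]].
have [u uP] := separable_sequence point sepU.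
(* A bound for the indices of the generators in W, and one for the lengths; the
   generators of larger index are sent to 1. *)
pose n := (\max_(w <- W) \max_(l <- free_word w) l.1.+1)%N.
pose k := (\max_(w <- W) size (free_word w))%N.
pose g i := if (i < n)%N then tau (free_gen i) else 1%g.
have gE w : w \in W -> word_ev g w = tau w.
  move=> wW; rewrite free_hom_word; apply: word_ev_eq => l lw.
  rewrite /g ifT//; apply: leq_trans
    (@leq_bigmax_seq _ _ xpredT (fun w => \max_(l <- free_word w) l.1.+1)%N
       w wW isT).
  exact: (@leq_bigmax_seq _ _ xpredT (fun l : letter => l.1.+1) l lw).
have g1 i : (n <= i)%N -> g i = 1%g by rewrite /g leqNgt => /negbTE ->.
pose eta := e / k.+1%:R.
have eta0 : 0 < eta by rewrite divr_gt0.
pose A := S ++ [seq tau w x | w <- W, x <- S].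
have [Gam [c [P [eqP P1 Pc]]]] := finite_equivariant_model A extU g1 eta0.
have [K [PK eqK] Ku] := equivariant_sequence u extU eqP.
have [|h hM hK] := equivariant_action eqK.
  move=> x d d0; have [|n' un'] := uP (ball x d)°%classic (@open_interior _ _).
    by exists x; exact: nbhsx_ballx.
  have [p Kp p1] := Ku n'; exists p, 1%g; split=> //.
  by have := interior_subset un'; rewrite ballEmdist p1.
exists (free_extension (h \o c) : free_hom (Iso U)); last first.
  apply: (@sub_finite_set _ _ (range h)); last exact/finite_image/finite_finset.
  move=> _ [w _ <-]; exists (word_ev c w) => //.
  by rewrite /free_extension -word_ev_morph.
apply: WSV => w x wW xS.
have xA : x \in A by rewrite mem_cat xS.
have twA : tau w x \in A.
  by rewrite mem_cat; apply/orP; right; apply/allpairsP; exists (w, x).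
rewrite /= /free_extension word_ev_morph// -{1}(P1 _ xA) hK; last first.
  by apply: PK; exact: map_f.
rewrite mulg1 metric_sym (le_lt_trans (Pc w _ _ twA xA))// gE// mdistxx add0r.
rewrite -mulr_natr /eta -mulrA gtr_pMr// mulrC ltr_pdivrMr// mul1r ltr_nat ltnS.
exact: (@leq_bigmax_seq _ _ xpredT (fun w => size (free_word w)) w wW).
Qed.

(** * Polish subgroups are closed *)

(** Nested balls with radii tending to 0 are chosen so that the ball of twice
    the (n+1)-st radius lies in V n: the doubling makes the limit of the
    centres, which is only in the closure of each ball, stay in V n. *)
Lemma baire_complete_metric (R : realType) (M : completeMetricType R)
    (V : nat -> set M) :
  (forall n, open (V n) /\ dense (V n)) -> dense (\bigcap_n V n).
Proof.
move=> odV D [x0 Dx0] oD.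
have openball (A : set M) x : open A -> A x ->
    exists2 r, 0 < r & ball x (r *+ 2) `<=` A.
  move=> oA Ax; have : nbhs x A by exact: open_nbhs_nbhs.
  rewrite -nbhs_ballE => -[r /= r0 rA].
  exists (r / 2); first by rewrite divr_gt0.
  by rewrite mulr2n -splitr.
have [r0 r0_gt0 r0D] := openball D x0 oD Dx0.
have /choice[F FP] : forall i : nat * (M * R), exists j : M * R,
    0 < i.2.2 -> [/\ 0 < j.2, j.2 <= i.1.+1%:R^-1 &
                     ball j.1 (j.2 *+ 2) `<=` ball i.2.1 i.2.2 `&` V i.1].
  move=> [n [x r]] /=; have [rP|rN] := pselect (0 < r); last by exists (x, r).
  have [oVn dVn] := odV n.
  have ox : open (ball x r)° by exact: open_interior.
  have [|y [xy Vy]] := dVn _ _ ox; first by exists x; exact: nbhsx_ballx.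
  have [|s s0 sB] := openball ((ball x r)° `&` V n) y (openI ox oVn).
    by [].
  exists (y, Num.min s n.+1%:R^-1) => _ /=; split.
  - by rewrite lt_min s0 invr_gt0 ltr0n.
  - by rewrite ge_min lexx orbT.
  - move=> z Bz; have [|zx zV] := sB z; last first.
      by split=> //; exact: interior_subset.
    by apply: le_ball Bz; rewrite lerMn2r/= ge_min lexx.
pose s := fix s n := if n is n'.+1 then F (n', s n') else (x0, r0).
have s0 n : 0 < (s n).2.
  by elim: n => //= n IH; have [] := FP (n, s n) IH.
have sS n : (s n.+1).2 <= n.+1%:R^-1 by have [] := FP (n, s n) (s0 n).
have sB n : ball (s n.+1).1 ((s n.+1).2 *+ 2) `<=` ball (s n).1 (s n).2 `&` V n.
  by have [] := FP (n, s n) (s0 n).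
have ball2 n : ball (s n).1 (s n).2 `<=` ball (s n).1 ((s n).2 *+ 2).
  by apply: le_ball; rewrite mulr2n lerDl ltW.
have sball n m : (n <= m)%N -> ball (s n).1 (s n).2 (s m).1.
  move=> /subnK <-; have : ball (s (m - n + n)%N).1 (s (m - n + n)%N).2 `<=`
      ball (s n).1 (s n).2.
    elim: (m - n)%N => [|d IH] //=.
    apply: subset_trans IH => z zB.
    by have [] := sB _ z (ball2 (d + n).+1 z zB).
  by apply; exact: ballxx.
have /cauchy_cvg/cvg_ex[y sy] : cauchy ((fun n => (s n).1) @ \oo).
  apply: cauchy_exP => e e0; pose n := Num.bound e^-1.
  exists (s n.+1).1, n.+1 => // m /= nm; apply: le_ball (sball _ _ nm).
  rewrite (le_trans (sS n))// -[leRHS]invrK lef_pV2 ?posrE ?invr_gt0//.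
  rewrite (le_trans (ltW (archi_boundP _)))// ?invr_ge0 ?ltW//.
  by rewrite ltr_nat.
have yB n : ball (s n).1 ((s n).2 *+ 2) y.
  have [N _ NB] : ((fun n => (s n).1) @ \oo) (ball y (s n).2).
    exact: sy _ (nbhsx_ballx _ _ _).
  rewrite mulr2n; apply: (ball_triangle (sball n (maxn n N) (leq_maxl _ _))).
  by apply: ball_sym; apply: NB => /=; exact: leq_maxr.
exists y; split; first by apply: r0D; exact: (yB 0%N).
by move=> n _; have [] := sB n y (yB n.+1).
Qed.

Lemma continuous_mulg (G : topologicalGroupType) (T : topologicalType)
    (f g : T -> G) :
  continuous f -> continuous g -> continuous (fun x => f x * g x)%g.
Proof.
move=> cf cg x; apply: (@continuous_comp _ _ _ (fun x => (f x, g x))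
  (fun z : G * G => z.1 * z.2)%g); last exact: mulg_continuous.
exact: cvg_pair (cf x) (cg x).
Qed.

(** Let O n be the union of the open sets whose trace on G has diameter less
    than 1/(n+1) for a complete metric. By completeness, the intersection of the
    O n meets the closure of the range only in the range. For g in this closure,
    the elements m of G such that O n contains g * phi m form a dense open
    subset of G; hence, by Baire's theorem, some g * phi m lies in every O n,
    so that g * phi m, and thus g, belongs to the range. *)
Lemma polish_range_closed (R : realType) (G H : topologicalGroupType)
    (phi : {multiplicative G -> H}) :
  hausdorff_space H -> polish R G -> topological_group_embedding phi ->
  closed (range phi).
Proof.
move=> hH [M _ [f [k [fK kK cf ck]]]] [phi_inj phi_open].
have cphi : continuous phi.
  by apply/continuousP => W oW; apply/phi_open; exists W.
pose small n (W : set H) := forall x y, W (phi x) -> W (phi y) ->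
  mdist (f x) (f y) < n.+1%:R^-1.
pose O n := \bigcup_(W in [set W | open W /\ small n W]) W.
have oO n : open (O n) by apply: bigcup_open => W [].
have phiO n x : O n (phi x).
  have e0 : 0 < (n.+1%:R^-1 / 2 : R) by rewrite divr_gt0.
  have /phi_open[W oW Wf] : open (f @^-1` (ball (f x) (n.+1%:R^-1 / 2))°).
    by apply: open_comp; [move=> ? _; exact: cf|exact: open_interior].
  have WP y : W (phi y) -> mdist (f x) (f y) < n.+1%:R^-1 / 2.
    move=> Wy; have : (phi @^-1` W) y by [].
    by rewrite Wf /= => /interior_subset; rewrite ballEmdist.
  exists W; last first.
    rewrite -[W (phi x)]/((phi @^-1` W) x) Wf /=; exact: nbhsx_ballx.
  split=> // y z /WP xy /WP xz.
  rewrite (le_lt_trans (metric_triangle _ (f x) _))//.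
  by rewrite metric_sym [ltRHS]splitr ltrD.
have O_range g : closure (range phi) g -> (forall n, O n g) -> range phi g.
  move=> cg Og; pose F := filter_from (nbhs g) (fun B => f @` (phi @^-1` B)).
  have FF : ProperFilter F.
    apply: filter_from_proper => [|B Bg]; last first.
      by have [_ [[x _ <-] Bx]] := cg B Bg; exists (f x), x.
    apply: filter_from_filter => [|B C Bg Cg].
      by exists setT; exact: filterT.
    exists (B `&` C); first exact: filterI.
    by move=> _ [x [Bx Cx] <-]; split; exists x.
  have /cauchy_cvg/cvg_ex[m Fm] : cauchy F.
    apply: cauchy_exP => e e0; pose n := Num.bound e^-1.
    have [W [oW Ws] Wg] := Og n; have nW : nbhs g W by exact: open_nbhs_nbhs.
    have [_ [[x _ <-] Wx]] := cg W nW.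
    exists (f x), W => // _ [y Wy <-]; rewrite ballEmdist/=.
    rewrite (lt_le_trans (Ws _ _ Wx Wy))// -[leRHS]invrK.
    rewrite lef_pV2 ?posrE ?invr_gt0//.
    rewrite (le_trans (ltW (archi_boundP _)))// ?invr_ge0 ?ltW//.
    by rewrite ltr_nat.
  have ckm : (phi \o k) @ F --> phi (k m).
    apply: (@cvg_comp _ _ _ _ (phi \o k) F (nbhs m)) => //.
    by apply: continuous_comp; [exact: ck|exact: cphi].
  exists (k m) => //; apply: (@cvg_unique _ hH ((phi \o k) @ F) _ _ _ ckm).
  by move=> B Bg; exists B => // _ [x Bx <-] /=; rewrite fK.
move=> g cg.
have cgM x : closure (range phi) (g * phi x)%g.
  have cx : continuous (fun h : H => h * phi x)%g.
    by apply: continuous_mulg; [move=> ?; exact: cvg_id|exact: cst_continuous].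
  move=> B /(cx g)/cg[_ [[y _ <-] By]]; exists (phi (y * x)%g).
  by split; [exists (y * x)%g|rewrite gmulfM].
pose V n := [set m : M | O n (g * phi (k m))%g].
have dV n : open (V n) /\ dense (V n).
  split.
    apply: (@open_comp _ _ (fun m => g * phi (k m))%g) => // m _.
    apply: (@continuous_mulg H M (fun=> g) (phi \o k)).
      exact: cst_continuous.
    by move=> z; apply: continuous_comp; [exact: ck|exact: cphi].
  move=> D [m0 Dm0] oD.
  have /phi_open[W oW WD] : open (f @^-1` D).
    by apply: open_comp => // ? _; exact: cf.
  have WP x : W (phi x) = D (f x).
    by rewrite -[LHS]/((phi @^-1` W) x) WD.
  pose A := [set h : H | W (g^-1 * h)%g].
  have oA : open A.
    apply: (@open_comp _ _ (fun h : H => g^-1 * h)%g) => // h _.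
    by apply: (@continuous_mulg H H (fun=> g^-1)%g id);
      [exact: cst_continuous|move=> ?; exact: cvg_id].
  have [|_ [[y _ <-] Ay]] := cgM (k m0) A.
    by apply: open_nbhs_nbhs; split=> //; rewrite /A/= mulKg WP kK.
  (* As phi y belongs to A and to O n, so does g * h^-1 * phi y for every h near
     g, in particular for some h in the range. *)
  have cQ : continuous (fun h : H => g * (h^-1 * phi y))%g.
    apply: (@continuous_mulg H H (fun=> g)); first exact: cst_continuous.
    apply: continuous_mulg; last exact: cst_continuous.
    exact: invg_continuous.
  have : nbhs (g * (g^-1 * phi y))%g (O n `&` A).
    by rewrite mulKVg; apply: open_nbhs_nbhs; split; [exact: openI|].
  move=> /(cQ g)/cg[_ [[t _ <-]]] /=.
  rewrite -(mulg_morphV (@gmulfM _ _ phi)) -gmulfM => -[Ot At].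
  exists (f (t^-1 * y)%g); split; last by rewrite /V/= fK.
  by rewrite -WP; move: At; rewrite /A/= mulKg.
have [|m [_ Vm]] := baire_complete_metric dV _ openT; first by exists point.
have [|x _ xE] := O_range _ (cgM (k m)); first by move=> n; exact: Vm.
exists (x * (k m)^-1)%g => //.
by rewrite gmulfM (mulg_morphV (@gmulfM _ _ phi)) xE mulgK.
Qed.

Lemma iso_hausdorff (R : realType) (U : metricType R) : hausdorff_space (Iso U).
Proof.
move=> p q pq; apply: iso_eq => x; apply: (@metric_hausdorff _ U) => A B Ap Bq.
have ev (h : Iso U) : (fun h' : Iso U => h' x) @ nbhs h --> h x.
  exact: ((@iso_cvgP R U (nbhs h) h (nbhs_filter h)).1 (@cvg_id _ (nbhs h))).
by have [h [Ah Bh]] := pq _ _ (ev p _ Ap) (ev q _ Bq); exists (h x).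
Qed.

(** * Finite subgroups converging to a Polish subgroup *)

Lemma closure_range_continuous (G : topologicalGroupType) :
  continuous (@closure_range G).
Proof. by apply/continuousP. Qed.

Lemma polish_separable (R : realType) (G : topologicalGroupType) :
  polish R G -> separable_space G.
Proof.
move=> [M [D cD dD] [f [k [fK kK cf ck]]]].
exists (k @` D); first exact: card_le_trans (card_image_le _ _) cD.
move=> V [x Vx] oV; have [||y [Vy Dy]] := dD (k @^-1` V).
- by exists (f x); rewrite /= fK.
- by apply: open_comp => // ? _; exact: ck.
by exists (k y); split=> //; exists y.
Qed.

Lemma dense_free_hom (G H : topologicalGroupType)
    (phi : {multiplicative G -> H}) :
  continuous phi -> separable_space G ->
  exists tau : free_hom H,
    range tau `<=` range phi /\ range phi `<=` closure (range tau).
Proof.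
move=> cphi sepG; have [v vP] := separable_sequence 1%g sepG.
exists (free_extension (phi \o v)); split.
  move=> _ [w _ <-]; exists (word_ev v w) => //.
  by rewrite -(word_ev_morph _ _ (@gmulfM _ _ phi)).
move=> _ [x _ <-] B; rewrite nbhsE => -[C [oC Cx] CB].
have [||n Cn] := vP (phi @^-1` C).
- by apply: open_comp => // ? _; exact: cphi.
- by exists x.
exists (phi (v n)); split; last exact: CB.
by exists (free_gen n) => //; rewrite /= /free_extension /= mulg1.
Qed.

Theorem corollary4p9 (R : realType) (U : completeMetricType R)
    (G : topologicalGroupType) (phi : {multiplicative G -> Iso U}) :
  urysohn_space U ->
  polish R G ->
  topological_group_embedding phi ->
  exists2 H : closed_subgroup (Iso U),
    (H : set (Iso U)) = range phi &
    exists (D : Type) (le : D -> D -> Prop) (N : D -> closed_subgroup (Iso U)),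
      [/\ directed le,
          forall i, finite_set (N i : set (Iso U)) &
          N @ tails le --> H].
Proof.
move=> urU polG embG; have hI := @iso_hausdorff R U.
have cphi : continuous phi.
  by apply/continuousP => W oW; apply/(proj2 embG); exists W.
have [tau [tau_phi phi_tau]] := dense_free_hom cphi (polish_separable polG).
have clphi : closed (range phi) := polish_range_closed hI polG embG.
exists (closure_range tau).
  apply/seteqP; split=> //.
  by rewrite [range phi](closure_id _).1//; exact: closureS.
have /choice[s sP] : forall V : {V : set (free_hom (Iso U)) | nbhs tau V},
    exists sg : free_hom (Iso U), sval V sg /\ finite_set (range sg).
  by move=> [V nV]; have [sg] := finite_range_approximation urU nV; exists sg.
exists {V : set (free_hom (Iso U)) | nbhs tau V},
  (fun V W => sval W `<=` sval V), (fun V => closure_range (s V)); split.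
- split=> [||V W X VW WX|V W].
  + by exists; exists setT; exact: filterT.
  + by move=> V f.
  + exact: subset_trans VW.
  + by exists (exist _ _ (filterI (svalP V) (svalP W))) => /=; split=> f [].
- move=> V; have [_ fin] := sP V.
  have clfin := accessible_finite_set_closed.1 (hausdorff_accessible hI) _ fin.
  by rewrite /closure_range /= -((closure_id _).1 clfin).
- move=> B /closure_range_continuous nB.
  exists (exist _ (@closure_range (Iso U) @^-1` B) nB) => // V VB.
  exact: VB (sP V).1.
Qed.
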